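(* The Lyapunov function $\Lambda(x)$, $x\in\mathbb{R}P^1$, is $GL_2(\mathbb Z)$-invariant: $$\Lambda\left(\frac{ax+b}{cx+d}\right)=\Lambda(x),\quad x\in\mathbb{R}P^1,$$ for all integers $a,b,c,d$ satisfying $ad-bc=\pm1$.
   Context: $\mathbb{R}P^1=\mathbb R\cup\{\infty\}$ with the usual action by fractional linear transformations. Let $L=\begin{pmatrix}1&1\\0&1\end{pmatrix}$, $R=\begin{pmatrix}1&0\\1&1\end{pmatrix}$. Path on the Farey tree. For real $x\ge 0$ define matrices $A_n(x)=\begin{pmatrix}a_n&b_n\\c_n&d_n\end{pmatrix}$ by $A_0(x)=I$ and $A_{n+1}(x)=A_n(x)R$ if $x<\frac{a_n+b_n}{c_n+d_n}$, $A_{n+1}(x)=A_n(x)L$ if $x>\frac{a_n+b_n}{c_n+d_n}$. If equality $x=\frac{a_n+b_n}{c_n+d_n}$ occurs (this happens only for positive rational $x$), the path is continued by the turns $L,R,R,R,\dots$ or by the turns $R,L,L,L,\dots$; either choice may be used. Lyapunov function. Let $w_n(x)$ be the largest entry of $A_n(x)$ (for $x\in[0,1)$, $n\ge1$, it is $\max(c_n,d_n)$). For real $x\ge0$, $\Lambda(x)=\limsup_{n\to\infty}\frac{\ln w_n(x)}{n}$. It is extended by $\Lambda(-x)=\Lambda(x)$ and $\Lambda(\infty)=0$. *)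

(* Defs.v *)
From mathcomp Require Import all_boot all_order all_algebra.
From mathcomp Require Import all_classical all_reals all_analysis.
From mathcomp Require Import zify.

Set Implicit Arguments.
Unset Strict Implicit.
Unset Printing Implicit Defensive.

Import Order.TTheory GRing.Theory Num.Theory.

Local Open Scope ring_scope.

Definition mx2 (T : Type) (a b c d : T) : 'M[T]_2 :=
  \matrix_(i, j) if i == 0 then (if j == 0 then a else b)
                 else (if j == 0 then c else d).

(* The entries of the path matrices are natural numbers. *)
Definition matL : 'M[nat]_2 := mx2 1%N 1%N 0%N 1%N.
Definition matR : 'M[nat]_2 := mx2 1%N 0%N 1%N 1%N.

Section Path.
Variable R : realType.

Definition mediant (A : 'M[nat]_2) : R :=
  (A 0 0 + A 0 1)%:R / (A 1 0 + A 1 1)%:R.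

(* The step made from A by the path towards x; [tie] is the turn chosen when
   x is equal to the mediant (true for L, false for R). *)
Definition farey_step (tie : bool) (x : R) (A : 'M[nat]_2) : 'M[nat]_2 :=
  if x < mediant A then A *m matR
  else if mediant A < x then A *m matL
  else if tie then A *m matL else A *m matR.

(* A_n(x), for x >= 0. Once the turn L (resp. R) has been chosen at an
   equality, the strict comparisons force the continuation R, R, R, ...
   (resp. L, L, L, ...); see [farey_path_tie] below. *)
Fixpoint farey_path (tie : bool) (x : R) (n : nat) : 'M[nat]_2 :=
  if n is m.+1 then farey_step tie x (farey_path tie x m) else 1%:M.

Definition largest_entry (A : 'M[nat]_2) : nat :=
  (\max_(i < 2) \max_(j < 2) A i j)%N.

(* The limit superior is taken in the extended reals. The term of index 0
   is 0, by the convention 0^-1 = 0. *)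
Definition lyapunov_nneg (tie : bool) (x : R) : \bar R :=
  limn_esup (fun n : nat =>
    (ln (largest_entry (farey_path tie x n))%:R / n%:R)%:E).

Inductive RP1 : Type := Fin of R | Infty.

(* [tie x] is the choice made at x >= 0, so that the choices at different
   positive rational numbers are independent. *)
Definition lyapunov (tie : R -> bool) (p : RP1) : \bar R :=
  match p with
  | Fin x => lyapunov_nneg (tie `|x|) `|x|
  | Infty => 0%E
  end.

Definition moebius (a b c d : int) (p : RP1) : RP1 :=
  match p with
  | Fin x => if c%:~R * x + d%:~R == 0 then Infty
             else Fin ((a%:~R * x + b%:~R) / (c%:~R * x + d%:~R))
  | Infty => if c == 0 then Infty else Fin (a%:~R / c%:~R)
  end.

Lemma mulmxL (A : 'M[nat]_2) :
  A *m matL = mx2 (A 0 0) (A 0 0 + A 0 1) (A 1 0) (A 1 0 + A 1 1).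
Proof.
apply/matrixP => i j; rewrite !mxE big_ord_recl big_ord1 !mxE /=.
have -> : lift ord0 ord0 = 1 :> 'I_2 by apply/val_inj.
have E (k : 'I_2) : k = 0 \/ k = 1.
  by case: k => [[|[|//]] kP]; [left|right]; apply/val_inj.
by have [->|->] := E i; have [->|->] := E j;
  rewrite /= ?(@mulr1 nat) ?(@mulr0 nat) ?(@addr0 nat) ?(@add0r nat).
Qed.

Lemma mulmxR (A : 'M[nat]_2) :
  A *m matR = mx2 (A 0 0 + A 0 1) (A 0 1) (A 1 0 + A 1 1) (A 1 1).
Proof.
apply/matrixP => i j; rewrite !mxE big_ord_recl big_ord1 !mxE /=.
have -> : lift ord0 ord0 = 1 :> 'I_2 by apply/val_inj.
have E (k : 'I_2) : k = 0 \/ k = 1.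
  by case: k => [[|[|//]] kP]; [left|right]; apply/val_inj.
by have [->|->] := E i; have [->|->] := E j;
  rewrite /= ?(@mulr1 nat) ?(@mulr0 nat) ?(@addr0 nat) ?(@add0r nat).
Qed.

Lemma farey_path_det tie x n (A := farey_path tie x n) :
  (A 0%R 0%R * A 1%R 1%R = (A 0%R 1%R * A 1%R 0%R).+1)%N.
Proof.
rewrite {}/A; elim: n => [|n IH]; first by rewrite !mxE.
rewrite /= /farey_step; move: (farey_path tie x n) IH => A HA.
by do !case: ifP => _; rewrite ?mulmxL ?mulmxR !mxE /=
  ?mulnDr ?mulnDl HA ?addnS ?addSn // addnC.
Qed.

Lemma det_pos (a b c d : nat) : (a * d = (b * c).+1 -> 0 < c + d)%N.
Proof. by case: d => [|d]; rewrite ?muln0 // addnS. Qed.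

Lemma farey_path_tie tie x n (A := farey_path tie x n) : x = mediant A ->
  forall k, farey_path tie x (n + k).+1 =
    iter k (mulmx^~ (if tie then matR else matL))
           (A *m (if tie then matL else matR)).
Proof.
move=> xE; have := farey_path_det tie x n; rewrite -/A => HA.
have s0 : (0 < A 1%R 0%R + A 1%R 1%R)%N by exact: det_pos HA.
set B := A *m _; set T := if tie then matR else matL.
pose P (M : 'M[nat]_2) :=
  (M 0%R 0%R * M 1%R 1%R = (M 0%R 1%R * M 1%R 0%R).+1)%N /\
  let u := (A 0%R 0%R + A 0%R 1%R)%N in let v := (A 1%R 0%R + A 1%R 1%R)%N in
  if tie then M 0%R 1%R = u /\ M 1%R 1%R = v
  else M 0%R 0%R = u /\ M 1%R 0%R = v.
have PB : P B.
  rewrite /P /B; case: tie {T B P xE HA A s0} (A) HA => A HA;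
    rewrite ?mulmxL ?mulmxR !mxE /=; nia.
have PT M : P M -> farey_step tie x M = M *m T /\ P (M *m T).
  rewrite /P /T /farey_step => -[HM].
  have sM : (0 < M 1%R 0%R + M 1%R 1%R)%N by exact: det_pos HM.
  case: (tie) => -[E0 E1]; split.
  - rewrite xE /mediant ltr_pdivrMr ?ltr0n // mulrAC ltr_pdivlMr ?ltr0n //.
    by rewrite -!natrM ltr_nat ifT // -E0 -E1; nia.
  - by rewrite mulmxR !mxE /=; nia.
  - rewrite xE /mediant !ltr_pdivrMr ?ltr0n // ![_ / _ * _]mulrAC.
    rewrite !ltr_pdivlMr ?ltr0n // -!natrM !ltr_nat -E0 -E1.
    by rewrite ifF ?ifT //; nia.
  - by rewrite mulmxL !mxE /=; nia.
elim=> [|k IH].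
  by rewrite addn0 /= -/A /farey_step -xE ltxx /B; case: (tie).
have PI : P (iter k (mulmx^~ T) B).
  by elim: k {IH} => //= k /PT[].
by rewrite addnS iterS -(proj1 (PT _ PI)) -IH.
Qed.

End Path.

Arguments Infty {R}.

(* Main.v *)
Require Import Defs.
From mathcomp Require Import all_boot all_order all_algebra.
From mathcomp Require Import all_classical all_reals all_analysis.
From mathcomp Require Import zify ring lra.

Import Order.TTheory GRing.Theory Num.Theory.

Local Open Scope ring_scope.

(* The limit superior only depends on w_n(x) up to a bounded factor. If x > 0,
   then A_(n+1)(x + 1) = L A_n(x), whose largest entry differs from w_n(x) by a
   factor at most 2, and A_n(1/x) is A_n(x) conjugated by the swap of the two
   coordinates. So Lambda is invariant under x -> x + 1 and x -> 1/x for x > 0.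
   For 0 < t < 1, write t = 1/(1 + u) and 1 - t = 1/(1 + 1/u) to get
   Lambda(t) = Lambda(u) = Lambda(1/u) = Lambda(1 - t), which gives translation
   invariance across 0. The Euclidean algorithm then shows that Lambda vanishes
   at rational points and is GL_2(Z)-invariant at irrational ones. *)

(** * Growth rates of integer sequences *)

Lemma limn_esup_le_near {R : realType} (u v : nat -> R) :
  (forall e, 0 < e -> exists N, forall n, (N <= n)%N -> u n <= v n + e) ->
  (limn_esup (fun n => (u n)%:E) <= limn_esup (fun n => (v n)%:E))%E.
Proof.
move=> uv; rewrite /limn_esup /limf_esup.
apply: le_ereal_inf_tmp => _ [V [N _ NV] <-].
apply/lee_addgt0Pr => e e0; have [M uvM] := uv _ e0.
set W := [set n | (maxn M N <= n)%N]%classic.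
apply: (@le_trans _ _ (ereal_sup ((fun n => (u n)%:E) @` W)%classic)).
  by apply: ereal_inf_lbound; exists W => //; exists (maxn M N).
apply: ge_ereal_sup => _ [n /= Wn <-].
apply: (@le_trans _ _ ((v n)%:E + e%:E)%E).
  by rewrite lee_fin uvM // (leq_trans _ Wn) // leq_maxl.
rewrite leeD2r //; apply: ereal_sup_ubound; exists n => //.
by apply: NV; rewrite /= (leq_trans _ Wn) // leq_maxr.
Qed.

Lemma natr_unbounded {R : realType} (a e : R) : 0 < e ->
  exists N, forall n, (N <= n)%N -> a <= e * n%:R.
Proof.
move=> e0; exists (Num.bound (`|a| / e)) => n Nn.
rewrite mulrC -ler_pdivrMr //; apply: (@le_trans _ _ (`|a| / e)).
  by rewrite ler_pM2r ?invr_gt0 ?ler_norm.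
have a0 : 0 <= `|a| / e by rewrite divr_ge0 // ltW.
by apply: le_trans (ltW (archi_boundP a0)) _; rewrite ler_nat.
Qed.

(** The factor 2 contributes only [ln 2 / n], which tends to 0. *)
Lemma growth_rate_le {R : realType} (v w : nat -> nat) :
  (forall n, 0 < v n)%N -> (forall n, v n <= 2 * w n)%N ->
  (limn_esup (fun n => (ln (v n)%:R / n%:R : R)%:E) <=
   limn_esup (fun n => (ln (w n)%:R / n%:R : R)%:E))%E.
Proof.
move=> v0 vw; apply: limn_esup_le_near => e e0.
have [N HN] := natr_unbounded (ln 2 : R) _ e0; exists N.+1 => n Nn.
have n0 : 0 < n%:R :> R by rewrite ltr0n (leq_trans _ Nn).
have w0 : (0 < w n)%N by have := v0 n; have := vw n; lia.
rewrite -(mulfK (lt0r_neq0 n0) e) -mulrDl ler_pM2r ?invr_gt0 //.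
apply: le_trans (_ : ln (2 * w n)%:R <= _).
  by rewrite ler_ln ?posrE ?ltr0n ?ler_nat ?muln_gt0 ?w0 // v0.
by rewrite natrM lnM ?posrE ?ltr0n // addrC lerD2l HN // ltnW.
Qed.

(** Since ln y = 2 ln(sqrt y) <= 2 sqrt y, linear growth of [w] makes the quotients O(1 / sqrt
    n). *)
Lemma growth_rate_linear {R : realType} (w : nat -> nat) (N C : nat) :
  (forall n, 0 < w n)%N -> (forall n, N <= n -> w n <= C * n)%N ->
  limn_esup (fun n => (ln (w n)%:R / n%:R : R)%:E) = 0%E.
Proof.
move=> w0 wC; apply/eqP; rewrite eq_le; apply/andP; split; last first.
  apply: limf_esup_ge0; first exact: (@filter_not_empty _ \oo%classic).
  by move=> n; rewrite lee_fin divr_ge0 // ln_ge0 // ler1n.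
have <- : limn_esup (fun=> (0 : R)%:E) = 0%E.
  by apply: (@cvg_limn_einf_sup R (fun=> 0%E) 0%E _).2; exact: cvg_cst.
apply: (@limn_esup_le_near R _ (fun=> 0)) => e e0.
(* The bound 4C <= e^2 n is what 2 sqrt(C n) <= e n becomes after squaring. *)
have [M HM] := natr_unbounded (4 * C%:R : R) _ (exprn_gt0 2 e0).
exists (maxn N M).+1 => n; rewrite gtn_max => /andP[Nn Mn].
have n0 : 0 < n%:R :> R by rewrite ltr0n (leq_trans _ Nn).
rewrite add0r ler_pdivrMr //; set y : R := (w n)%:R.
have y0 : 0 < y by rewrite ltr0n.
have yC : y <= C%:R * n%:R by rewrite -natrM ler_nat wC // ltnW.
have s0 : 0 < Num.sqrt y by rewrite sqrtr_gt0.
have -> : ln y = 2 * ln (Num.sqrt y).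
  by rewrite -{1}[y]sqr_sqrtr ?ltW // lnXn // mulr_natl.
apply: (@le_trans _ _ (2 * Num.sqrt y)).
  by rewrite ler_pM2l // ltW // ln_sublinear.
rewrite -(@ler_pXn2r _ 2) ?nnegrE ?mulr_ge0 ?(ltW e0) //.
rewrite exprMn sqr_sqrtr ?(ltW y0) //.
apply: (@le_trans _ _ (4 * C%:R * n%:R)); first by lra.
by rewrite exprMn expr2 [n%:R ^+ 2]expr2 mulrA ler_pM2r // -expr2 HM // ltnW.
Qed.

(** * Entries and mediants of the path matrices *)

Lemma matrix2P {T : Type} (A B : 'M[T]_2) :
  A 0 0 = B 0 0 -> A 0 1 = B 0 1 -> A 1 0 = B 1 0 -> A 1 1 = B 1 1 -> A = B.
Proof.
have E (k : 'I_2) : k = 0 \/ k = 1.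
  by case: k => [[|[|//]] kP]; [left|right]; apply/val_inj.
by move=> ? ? ? ?; apply/matrixP => i j;
  have [->|->] := E i; have [->|->] := E j.
Qed.

Lemma mulmx2E (A B : 'M[nat]_2) : A *m B =
  let: (a, b, c, d) := (A 0 0, A 0 1, A 1 0, A 1 1) in
  let: (a', b', c', d') := (B 0 0, B 0 1, B 1 0, B 1 1) in
  mx2 (a * a' + b * c') (a * b' + b * d') (c * a' + d * c') (c * b' + d * d').
Proof.
have l1 : lift ord0 ord0 = 1 :> 'I_2 by apply/val_inj.
by apply: matrix2P; rewrite !mxE big_ord_recl big_ord1 l1.
Qed.

Lemma largest_entryE (A : 'M[nat]_2) : largest_entry A =
  maxn (maxn (A 0%R 0%R) (A 0%R 1%R)) (maxn (A 1%R 0%R) (A 1%R 1%R)).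
Proof.
have l1 : lift ord0 ord0 = 1%R :> 'I_2 by apply/val_inj.
by rewrite /largest_entry !(big_ord_recl, big_ord0) l1 !maxn0.
Qed.

Lemma largest_entry_path_gt0 {R : realType} t (x : R) n :
  (0 < largest_entry (farey_path t x n))%N.
Proof. have := farey_path_det t x n; rewrite largest_entryE; nia. Qed.

Lemma farey_path_denom_gt0 {R : realType} t (x : R) n (A := farey_path t x n) :
  (0 < A 1%R 0%R + A 1%R 1%R)%N.
Proof. exact: det_pos (farey_path_det t x n). Qed.

Lemma farey_mediant_gt0 {R : realType} t (x : R) n :
  0 < mediant R (farey_path t x n).
Proof.
rewrite divr_gt0 // ltr0n ?farey_path_denom_gt0 //.
by move: (farey_path_det t x n) => /=;
  case: (farey_path t x n 0%R 0%R); rewrite ?mul0n.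
Qed.

(** * Paths whose turns are eventually constant *)

Lemma largest_entry_iter (T B : 'M[nat]_2) k : T = matL \/ T = matR ->
  (largest_entry (iter k (mulmx^~ T) B) <= (2 * k.+1) * largest_entry B)%N.
Proof.
(* Each factor [T] on the right adds one fixed column to the other, so the entries grow linearly in
   [k]. *)
rewrite !largest_entryE; case=> ->.
  suff [-> -> -> ->] : let M := iter k (mulmx^~ matL) B in
      [/\ M 0%R 0%R = B 0%R 0%R, M 0%R 1%R = B 0%R 1%R + k * B 0%R 0%R,
          M 1%R 0%R = B 1%R 0%R & M 1%R 1%R = B 1%R 1%R + k * B 1%R 0%R]%N by nia.
  elim: k => [|k /= [E1 E2 E3 E4]]; first by split; rewrite ?addn0.
  by rewrite mulmxL !mxE /= E1 E2 E3 E4; split=> //; lia.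
suff [-> -> -> ->] : let M := iter k (mulmx^~ matR) B in
    [/\ M 0%R 0%R = B 0%R 0%R + k * B 0%R 1%R, M 0%R 1%R = B 0%R 1%R,
        M 1%R 0%R = B 1%R 0%R + k * B 1%R 1%R & M 1%R 1%R = B 1%R 1%R]%N by nia.
elim: k => [|k /= [E1 E2 E3 E4]]; first by split; rewrite ?addn0.
by rewrite mulmxR !mxE /= E1 E2 E3 E4; split=> //; lia.
Qed.

Lemma lyapunov_nneg_eq0 {R : realType} t (x : R) N (T B : 'M[nat]_2) :
  T = matL \/ T = matR ->
  (forall k, farey_path t x (N + k) = iter k (mulmx^~ T) B) ->
  lyapunov_nneg t x = 0%E.
Proof.
(* Starting at [N.+1] excludes n = 0, so that 2(n - N + 1) <= 4n. *)
move=> HT HB; apply: (@growth_rate_linear R _ N.+1 (4 * largest_entry B)%N).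
  exact: largest_entry_path_gt0.
move=> n Nn; rewrite -[X in farey_path _ _ X](subnKC (ltnW Nn)) HB.
apply: leq_trans (largest_entry_iter _ _ _ HT) _; nia.
Qed.

Lemma lyapunov_nneg_tie0 {R : realType} t (x : R) n :
  x = mediant R (farey_path t x n) -> lyapunov_nneg t x = 0%E.
Proof.
move=> xE; apply: (@lyapunov_nneg_eq0 R t x n.+1 (if t then matR else matL)
  (farey_path t x n *m (if t then matL else matR))).
  by case: (t); [right|left].
by move=> k; rewrite addSn farey_path_tie.
Qed.

(** All mediants on a path are positive, so the path of 0 turns by R forever. *)
Lemma lyapunov_nneg0 {R : realType} t : lyapunov_nneg t (0 : R) = 0%E.
Proof.
apply: (@lyapunov_nneg_eq0 R t 0 0 matR 1%:M); first by right.
elim=> [//|k]; rewrite !add0n /= => <-; rewrite /farey_step ifT //.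
exact: farey_mediant_gt0.
Qed.

(** * Independence of the choice at ties *)

Lemma farey_path_tie_irrelevant {R : realType} t s (x : R) :
  (forall n, x <> mediant R (farey_path t x n)) ->
  forall n, farey_path s x n = farey_path t x n.
Proof.
move=> xA; elim=> //= n ->; rewrite /farey_step.
by case: ltgtP (xA n) => // ->.
Qed.

(** If both paths meet a tie, both values are 0. If one meets none, it makes no use of the choice,
    so the two paths coincide; a tie on just one of them is then impossible. *)
Lemma lyapunov_nneg_tie {R : realType} t s (x : R) :
  lyapunov_nneg t x = lyapunov_nneg s x.
Proof.
have [[n Hn]|Ht] := pselect (exists n, x = mediant R (farey_path t x n));
  have [[m Hm]|Hs] := pselect (exists n, x = mediant R (farey_path s x n)).
- by rewrite (lyapunov_nneg_tie0 _ _ _ Hn) (lyapunov_nneg_tie0 _ _ _ Hm).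
- case: (Hs); exists n; rewrite {1}Hn; congr mediant.
  by apply: farey_path_tie_irrelevant => k Hk; case: Hs; exists k.
- case: (Ht); exists m; rewrite {1}Hm; congr mediant.
  by apply: farey_path_tie_irrelevant => k Hk; case: Ht; exists k.
- congr limn_esup; apply/funext => n; rewrite (farey_path_tie_irrelevant s t) //.
  by move=> k Hk; case: Hs; exists k.
Qed.

(** * Translation by one on the nonnegative half-line *)

Lemma mediant_mulL {R : realType} (A : 'M[nat]_2) :
  (0 < A 1%R 0%R + A 1%R 1%R)%N -> mediant R (matL *m A) = mediant R A + 1.
Proof.
move=> A0; have {}A0 : (A 1 0 + A 1 1)%:R != 0 :> R by rewrite pnatr_eq0 -lt0n.
rewrite -[X in _ + X](divff A0) -mulrDl -natrD.
by rewrite /mediant mulmx2E /matL !mxE /=; congr (_%:R / _%:R); lia.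
Qed.

(** As x + 1 > 1, the first turn is L, whence the shift of the index. Left multiplication by L moves
    each mediant by 1, so all later comparisons agree. *)
Lemma farey_path_add1 {R : realType} t (x : R) n : 0 < x ->
  farey_path t (x + 1) n.+1 = matL *m farey_path t x n.
Proof.
move=> x0; elim: n => [|n IH].
  have m1 : mediant R 1%:M = 1 by rewrite /mediant !mxE /= divr1.
  have x1 : 1 < x + 1 by rewrite ltrDr.
  by rewrite /= /farey_step m1 ltNge (ltW x1) /= x1 mul1mx mulmx1.
rewrite [LHS]/= -/(farey_path t (x + 1) n.+1) IH /= /farey_step.
rewrite mediant_mulL ?farey_path_denom_gt0 // !ltrD2r.
by move: (farey_path t x n) => A; do !case: ifP => _; rewrite mulmxA.
Qed.

Lemma largest_entry_step {R : realType} t (x : R) A :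
  (largest_entry A <= largest_entry (farey_step t x A) <= 2 * largest_entry A)%N.
Proof.
rewrite /farey_step; do !case: ifP => _;
  rewrite ?mulmxL ?mulmxR !largest_entryE !mxE /=; lia.
Qed.

Lemma largest_entry_mulL (A : 'M[nat]_2) :
  (largest_entry A <= largest_entry (matL *m A) <= 2 * largest_entry A)%N.
Proof. rewrite mulmx2E !largest_entryE !mxE /=; lia. Qed.

Lemma lyapunov_nneg_add1 {R : realType} t (x : R) : 0 <= x ->
  lyapunov_nneg t (x + 1) = lyapunov_nneg t x.
Proof.
rewrite le_eqVlt => /predU1P[<-|x0].
  (* At x = 0 the path of x + 1 = 1 meets a tie at once, at the identity matrix. *)
  rewrite add0r lyapunov_nneg0 (@lyapunov_nneg_tie0 _ t 1 0) //.
  by rewrite /mediant !mxE /= divr1.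
pose w y n := largest_entry (farey_path t (y : R) n).
have w0 y n : (0 < w y n)%N by exact: largest_entry_path_gt0.
(* One more step changes the largest entry by a factor between 1 and 2, which absorbs the shift of
   the index. *)
have wx1 n : (w (x + 1)%R n <= w (x + 1)%R n.+1 <= 2 * w (x + 1)%R n)%N.
  exact: largest_entry_step.
have ww n : (w x n <= w (x + 1)%R n.+1 <= 2 * w x n)%N.
  by rewrite /w farey_path_add1 // largest_entry_mulL.
have [le1 le2] : (forall n, w (x + 1)%R n <= 2 * w x n)%N /\
    (forall n, w x n <= 2 * w (x + 1)%R n)%N.
  by split=> n; have := ww n; have := wx1 n; lia.
by apply/eqP; rewrite eq_le; apply/andP; split;
  apply: growth_rate_le => //; apply: w0.
Qed.

(** * Inversion, as conjugation by the swap of coordinates *)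

Definition swapmx : 'M[nat]_2 := mx2 0%N 1%N 1%N 0%N.

Lemma mulmx_swapL : swapmx *m matL = matR *m swapmx.
Proof. by rewrite !mulmx2E; apply: matrix2P; rewrite !mxE. Qed.

Lemma mulmx_swapR : swapmx *m matR = matL *m swapmx.
Proof. by rewrite !mulmx2E; apply: matrix2P; rewrite !mxE. Qed.

Lemma swapE (A : 'M[nat]_2) :
  swapmx *m A *m swapmx = mx2 (A 1 1) (A 1 0) (A 0 1) (A 0 0).
Proof. by rewrite !mulmx2E; apply: matrix2P; rewrite !mxE /=; lia. Qed.

Lemma mediant_swap {R : realType} (A : 'M[nat]_2) :
  mediant R (swapmx *m A *m swapmx) = (mediant R A)^-1.
Proof. by rewrite swapE /mediant !mxE /= invf_div addnC [X in _ / X%:R]addnC. Qed.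

Lemma largest_entry_swap (A : 'M[nat]_2) :
  largest_entry (swapmx *m A *m swapmx) = largest_entry A.
Proof. rewrite swapE !largest_entryE !mxE /=; lia. Qed.

(** Inversion reverses the order of the positive reals and conjugation by [swapmx] exchanges L and
    R; the turn at a tie is exchanged too, hence [~~ t]. *)
Lemma farey_path_inv {R : realType} t (x : R) n : 0 < x ->
  farey_path (~~ t) x^-1 n = swapmx *m farey_path t x n *m swapmx.
Proof.
move=> x0; elim: n => [|n IH] /=.
  by rewrite mulmx1 mulmx2E; apply: matrix2P; rewrite !mxE.
have m0 : 0 < mediant R (farey_path t x n) by exact: farey_mediant_gt0.
rewrite IH /farey_step mediant_swap !ltf_pV2 ?posrE //.
move: (farey_path t x n) => A; rewrite -!mulmxA mulmx_swapL mulmx_swapR.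
by case: ltgtP => //= _; case: (t); rewrite !mulmxA.
Qed.

Lemma lyapunov_nneg_inv {R : realType} t (x : R) : 0 <= x ->
  lyapunov_nneg t x^-1 = lyapunov_nneg t x.
Proof.
rewrite le_eqVlt => /predU1P[<-|x0]; first by rewrite invr0.
rewrite -(lyapunov_nneg_tie (~~ t)); congr limn_esup; apply/funext => n.
by rewrite farey_path_inv // largest_entry_swap.
Qed.

(** * The function on the whole real line *)

Definition lyapunov_real {R : realType} (x : R) : \bar R :=
  lyapunov_nneg true `|x|.

(** By independence of the choice, the fixed [true] in [lyapunov_real] stands for any [tie]. *)
Lemma lyapunov_Fin {R : realType} tie (x : R) :
  lyapunov tie (Fin x) = lyapunov_real x.
Proof. exact: lyapunov_nneg_tie. Qed.

Lemma lyapunov_realN {R : realType} (x : R) :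
  lyapunov_real (- x) = lyapunov_real x.
Proof. by rewrite /lyapunov_real normrN. Qed.

(* True also at x = 0, where 0^-1 = 0. *)
Lemma lyapunov_realV {R : realType} (x : R) :
  lyapunov_real x^-1 = lyapunov_real x.
Proof. by rewrite /lyapunov_real normfV lyapunov_nneg_inv. Qed.

Lemma lyapunov_real_add1 {R : realType} (x : R) :
  lyapunov_real (x + 1) = lyapunov_real x.
Proof.
have nneg (y : R) : 0 <= y -> lyapunov_real (y + 1) = lyapunov_real y.
  by move=> y0; rewrite /lyapunov_real !ger0_norm ?lyapunov_nneg_add1 ?addr_ge0.
have [/nneg //|x0] := leP 0 x; have [x1|x1] := leP x (-1).
  by rewrite -[RHS]lyapunov_realN -[LHS]lyapunov_realN -nneg ?opprD ?addrNK //; lra.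
(* Now -1 < x < 0, and [u] is chosen so that -x = 1/(1 + u); then x + 1 = 1/(1 + 1/u). *)
pose u := - x^-1 - 1.
have x0' : x != 0 by lra.
have x1' : x + 1 != 0 by lra.
have u0 : 0 <= u by rewrite /u -invrN subr_ge0 invf_ge1; lra.
have xE : x = - (u + 1)^-1 by rewrite /u subrK invrN invrK opprK.
have ux : u = - ((x + 1) / x) by rewrite /u; field.
have uV : u^-1 + 1 = (x + 1)^-1 by rewrite ux; field; rewrite ?x1' ?x0'.
rewrite [in RHS]xE lyapunov_realN lyapunov_realV (nneg u u0) -[RHS]lyapunov_realV.
by rewrite -[RHS]nneg ?invr_ge0 // uV lyapunov_realV.
Qed.

(** * The Euclidean algorithm at rational and irrational points *)

Lemma lyapunov_real_addz {R : realType} (x : R) (m : int) :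
  lyapunov_real (x + m%:~R) = lyapunov_real x.
Proof.
elim/int_rec: m => [|n IH|n IH]; first by rewrite addr0.
  by rewrite -addn1 PoszD intrD addrA lyapunov_real_add1.
rewrite -IH -[LHS]lyapunov_real_add1 -addrA -(intrD _ _ 1).
by congr (lyapunov_real (x + _%:~R)); lia.
Qed.

(** Removing the integer part of m/k and inverting gives k/r with 0 <= r < |k|. The descent ends at
    denominator 0, where the quotient is 0 by convention. *)
Lemma lyapunov_real_rat {R : realType} (m k : int) :
  lyapunov_real (m%:~R / k%:~R : R) = 0%E.
Proof.
have [n] := ubnP `|k|%N; elim: n m k => // n IH m k kn.
have [->|k0] := eqVneq k 0.
  by rewrite invr0 mulr0 /lyapunov_real normr0 lyapunov_nneg0.
have kR : k%:~R != 0 :> R by rewrite intr_eq0.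
rewrite {1}(divz_eq m k) intrD intrM mulrDl mulfK // addrC lyapunov_real_addz.
rewrite -lyapunov_realV invf_div IH //.
have := modz_ge0 m k0; have := ltz_mod m k0; lia.
Qed.

Lemma linear_neq0 {R : realType} (c d : int) (x : R) :
  (forall m k : int, x != m%:~R / k%:~R) -> c != 0 ->
  c%:~R * x + d%:~R != 0.
Proof.
move=> irr c0; have cR : c%:~R != 0 :> R by rewrite intr_eq0.
apply: contraNneq (irr (- d) c) => /eqP; rewrite addr_eq0 => /eqP cx.
by rewrite intrN -cx mulrC mulKf.
Qed.

(* For q = a %/ c, subtracting q and inverting turns the first column (a, c)
   into (c, a %% c), as in the Euclidean algorithm. *)
Lemma lyapunov_real_moebius {R : realType} (a b c d : int) (x : R) :
  (forall m k : int, x != m%:~R / k%:~R) ->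
  `|a * d - b * c| = 1 ->
  lyapunov_real ((a%:~R * x + b%:~R) / (c%:~R * x + d%:~R)) = lyapunov_real x.
Proof.
move=> irr; have [n] := ubnP `|c|%N.
elim: n a b c d => // n IH a b c d cn det.
have [c0|c0] := eqVneq c 0.
  (* For c = 0 both a and d are units, so the map is a sign change composed with an integer
     translation, up to sign. *)
  have [da dd] : (a = 1 \/ a = -1) /\ (d = 1 \/ d = -1).
    move: det; rewrite c0 mulr0 subr0 normrM -!abszE => -[] /eqP.
    by rewrite muln_eq1; lia.
  rewrite c0 mul0r add0r.
  have {}dd (y : R) : lyapunov_real (y / d%:~R) = lyapunov_real y.
    by case: dd => ->; rewrite ?divr1 // mulrN1z invrN invr1 mulrN1 lyapunov_realN.
  rewrite dd lyapunov_real_addz.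
  by case: da => ->; rewrite ?mul1r // mulrN1z mulN1r lyapunov_realN.
have cx0 : c%:~R * x + d%:~R != 0 by exact: linear_neq0.
set q := (a %/ c)%Z; set r := (a %% c)%Z.
have aE : a = q * c + r by exact: divz_eq.
rewrite -(lyapunov_real_addz _ (- q)) -lyapunov_realV.
rewrite -(IH c d r (b - q * d)).
- congr lyapunov_real; rewrite -[RHS]invf_div; congr (_ ^-1).
  apply: (mulIf cx0); rewrite mulrDl !divfK // aE.
  by rewrite !(intrD, intrM, intrN); ring.
- have := modz_ge0 a c0; have := ltz_mod a c0; rewrite -/r; lia.
(* Exchanging the rows flips the sign of the determinant, which is why the hypothesis bounds only
   its absolute value. *)
- rewrite -det -normrN; congr `|_|; rewrite [in RHS]aE; ring.
Qed.

Theorem corollary1 (R : realType) (tie : R -> bool) (a b c d : int) (p : RP1 R)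
    (habcd : a * d - b * c = 1 \/ a * d - b * c = -1) :
  lyapunov tie (moebius a b c d p) = lyapunov tie p.
Proof.
(* With [k] = 0 read as infinity, this covers the image of infinity as well as infinity itself. *)
have zero (m k : int) :
    lyapunov tie (if k == 0 then Infty else Fin (m%:~R / k%:~R)) = 0%E.
  by case: ifP => // _; rewrite lyapunov_Fin lyapunov_real_rat.
case: p => [x|]; last exact: zero.
(* A rational point is sent to a rational point or to infinity, so both sides vanish. *)
have [[m [k xE]]|irr] := pselect (exists m k : int, x = m%:~R / k%:~R).
  rewrite lyapunov_Fin [in RHS]xE lyapunov_real_rat /moebius.
  case: ifP => // cx; rewrite lyapunov_Fin xE.
  have [->|k0] := eqVneq k 0.
    by rewrite invr0 !mulr0 !add0r lyapunov_real_rat.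
  have kR : k%:~R != 0 :> R by rewrite intr_eq0.
  (* Putting b and d over [k] turns the image of m/k into (am + bk)/(cm + dk). *)
  rewrite -(mulfK kR b%:~R) -(mulfK kR d%:~R) !mulrA -!mulrDl.
  by rewrite -mulf_div divff ?invr_eq0 // mulr1 -!intrM -!intrD lyapunov_real_rat.
have {}irr (m k : int) : x != m%:~R / k%:~R.
  by apply/eqP => xE; apply: irr; exists m, k.
have cx : c%:~R * x + d%:~R != 0.
  have [c0|] := eqVneq c 0; last exact: linear_neq0.
  (* If c = 0, the determinant condition forces d to be nonzero. *)
  by rewrite c0 mul0r add0r intr_eq0; move: habcd; rewrite c0; nia.
rewrite /moebius (negPf cx) !lyapunov_Fin lyapunov_real_moebius //.
by case: habcd => ->; rewrite ?normrN1 ?normr1.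
Qed.
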